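(* Let $C = \{c_1 < c_2 < \cdots\}$ be an infinite set of natural numbers. If $\limsup_{i \to \infty} (c_{i+1} - c_i) = \infty$, then $C$ belongs to a co-minimal pair in the integers, i.e. there exists $W\subseteq\mathbb{Z}$ such that $C$ is a minimal additive complement to $W$ and $W$ is a minimal additive complement to $C$.
   Context: For $A,B\subseteq\mathbb{Z}$, $A+B=\{a+b: a\in A, b\in B\}$. $A$ is a minimal additive complement to $B$ (in $\mathbb{Z}$) if $A+B=\mathbb{Z}$ and $A'+B\ne\mathbb{Z}$ for every proper subset $A'\subsetneq A$. A pair $A,B$ is a co-minimal pair if each is a minimal additive complement to the other. *)

(* Defs.v *)
From mathcomp Require Import all_boot all_order all_algebra.
From mathcomp Require Import all_classical all_reals all_analysis.

Set Implicit Arguments.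
Unset Strict Implicit.
Unset Printing Implicit Defensive.

Import Order.TTheory GRing.Theory Num.Theory.

Local Open Scope classical_set_scope.
Local Open Scope ring_scope.

Definition sumset (A B : set int) : set int := [set a + b | a in A & b in B].

Definition minimal_additive_complement (A B : set int) : Prop :=
  sumset A B = setT /\ forall A' : set int, A' `<` A -> sumset A' B <> setT.

Definition co_minimal_pair (A B : set int) : Prop :=
  minimal_additive_complement A B /\ minimal_additive_complement B A.

(* c lists C = {c 0 < c 1 < ...}; indices start at 0. *)
Definition increasing_enumeration (C : set nat) (c : nat -> nat) : Prop :=
  {homo c : i j / (i < j)%N} /\ range c = C.

Definition int_of_nat_set (C : set nat) : set int := [set n%:Z | n in C].

(* Main.v *)
(* A covered interval [a, b] can be prolonged by one point on either side by
   adding a translate of [C] that avoids [a, b]: align a long gap of [C] with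
   [a, b]. Given [c] in [C], prolong [a, b] far to the right, up to the first
   uncovered point [x > b + c]; adding [x - c] covers [x] in one way only, and
   [x - c + C] lies to the right of [a, b] because [C >= 0]. Alternating these
   moves gives a complement [W] of [C] for which every integer has finitely many
   representations and every [c] in [C] has a point [x] reached only through [c].
   Local finiteness lets Zorn's lemma shrink [W] to a minimal complement [V], and
   the points [x] still witness that no element of [C] can be dropped. *)
Require Import Defs.
From mathcomp Require Import all_boot all_order all_algebra.
From mathcomp Require Import all_classical all_reals all_analysis.
From mathcomp Require Import zify.

Set Implicit Arguments.
Unset Strict Implicit.
Unset Printing Implicit Defensive.

Import Order.TTheory GRing.Theory Num.Theory.

Local Open Scope classical_set_scope.
Local Open Scope ring_scope.

Lemma sumsetP (A B : set int) (z : int) :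
  sumset A B z <-> exists2 w, A w & B (z - w).
Proof.
split=> [[w Aw [c Bc <-]]|[w Aw Bzw]]; first by exists w => //; rewrite addrAC subrr add0r.
by exists w => //; exists (z - w) => //; rewrite addrC subrK.
Qed.

Lemma sumsetC (A B : set int) : sumset A B = sumset B A.
Proof.
by apply/seteqP; split=> z [a Aa [b Bb <-]]; exists b => //; exists a => //; rewrite addrC.
Qed.

Lemma sumsetSl (A A' B : set int) : A `<=` A' -> sumset A B `<=` sumset A' B.
Proof. by move=> sA z [a Aa [b Bb <-]]; exists a; [exact: sA|exists b]. Qed.

(** * Minimal complements by Zorn's lemma *)

Lemma finite_subset_chain (T : choiceType) (F : set (set T)) (A : set T) :
  total_on F subset -> F !=set0 -> finite_set A -> A `<=` \bigcup_(X in F) X ->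
  exists2 X, F X & A `<=` X.
Proof.
move=> Ftot [X0 FX0] /finite_seqP[s ->] {A}.
elim: s => [|x s IHs] sF; first by exists X0.
have [|X FX sX] := IHs; first by move=> y /= ys; apply: sF; rewrite /= inE ys orbT.
have [Y FY Yx] := sF x (mem_head x s).
have [XY|YX] := Ftot _ _ FX FY.
  by exists Y => // y /=; rewrite inE => /predU1P[->//|/sX/XY].
by exists X => // y /=; rewrite inE => /predU1P[->|/sX//]; apply: YX.
Qed.

Lemma locally_finite_minimal_complement (C W : set int) :
  sumset W C = setT ->
  (forall z, finite_set [set w | W w /\ C (z - w)]) ->
  exists2 V, V `<=` W & minimal_additive_complement V C.
Proof.
move=> WC Wfin.
(* [P] singles out the removable sets. A chain of them has a removable union: otherwise the finitely
   many [w] representing some [z] would all lie in one member of the chain. *)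
pose P (A : set int) := sumset (W `\` A) C = setT.
have [F FP Ftot|A [PA Amax]] := @Zorn_bigcup _ P.
  have [->|/set0P F0] := eqVneq F set0; first by rewrite /P bigcup_set0 setD0.
  apply/seteqP; split=> // z _; apply: contrapT => nz.
  have [|X FX sX] := finite_subset_chain Ftot F0 (Wfin z).
    move=> w [Ww Czw]; apply: contrapT => nw; apply: nz; apply/sumsetP.
    by exists w.
  have : sumset (W `\` X) C z by rewrite (FP _ FX).
  by move=> /sumsetP[w [Ww nXw] Czw]; apply: nXw; apply: sX.
exists (W `\` A) => [w [] //|]; split=> // V [VWA WAV] VC.
(* Removing [A] together with the complement of [V] leaves exactly [V]. *)
apply: (Amax (A `|` ~` V)) => [|]; last first.
  rewrite /P; apply/seteqP; split=> // z _.
  have : sumset V C z by rewrite VC.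
  apply: sumsetSl => v Vv; have [Wv nAv] := VWA v Vv.
  by split=> // -[].
split; first by move=> w; left.
by move=> sA; apply: WAV => w [Ww nAw]; apply: contrapT => nVw; apply/nAw/sA; right.
Qed.

(** * Prolonging covered intervals *)

Definition arbitrarily_long_gaps (C : set int) : Prop :=
  forall L : int, exists p q : int,
    [/\ C p, C q, p + L < q & forall y, p < y < q -> ~ C y].

Definition covers (C : set int) (W : seq int) (a b : int) : Prop :=
  forall z, a <= z <= b -> sumset [set` W] C z.

(* The last condition says that the translates of [C] by the new elements of
   [W'] avoid [[a, b]], so representations of points of [[a, b]] are final. *)
Definition extension (C : set int) (W : seq int) (a b : int)
    (W' : seq int) (a' b' : int) : Prop :=
  [/\ {subset W <= W'}, a' <= a, b <= b', covers C W' a' b' &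
      forall w c, w \in W' -> C c -> a <= w + c <= b -> w \in W].

Lemma extension_refl (C : set int) W a b : covers C W a b -> extension C W a b W a b.
Proof. by split. Qed.

Lemma extension_trans (C : set int) W1 a1 b1 W2 a2 b2 W3 a3 b3 :
  extension C W1 a1 b1 W2 a2 b2 -> extension C W2 a2 b2 W3 a3 b3 ->
  extension C W1 a1 b1 W3 a3 b3.
Proof.
move=> [s12 a21 b12 _ old12] [s23 a32 b23 cov old23]; split=> //.
- by move=> w /s12/s23.
- exact: le_trans a32 a21.
- exact: le_trans b12 b23.
- move=> w c wW Cc wc; apply: (old12 w c) => //; apply: (old23 w c) => //; lia.
Qed.

Lemma covers_subset (C : set int) W W' a b :
  {subset W <= W'} -> covers C W a b -> covers C W' a b.
Proof. by move=> sW cov z /cov; apply: sumsetSl => w; apply: sW. Qed.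

Lemma extend_up1 (C : set int) W a b : arbitrarily_long_gaps C ->
  covers C W a b -> exists W', extension C W a b W' a (b + 1).
Proof.
move=> gapC cov.
have [cb|ncb] := pselect (sumset [set` W] C (b + 1)).
  exists W; split=> //; first lia.
  move=> z zab; have [->//|zb] := eqVneq z (b + 1); apply: cov; lia.
(* Translation by [b + 1 - q] sends [q] to [b + 1] and [p] below [a], so the gap swallows
   [[a, b]]. *)
have [p [q [Cp Cq pq gap]]] := gapC (b + 1 - a).
have sW : {subset W <= b + 1 - q :: W} by move=> w wW; rewrite inE wW orbT.
exists (b + 1 - q :: W); split=> //; first lia.
  move=> z zab; have [->|zb] := eqVneq z (b + 1).
    by apply/sumsetP; exists (b + 1 - q); [exact: mem_head|rewrite subKr].
  apply: (covers_subset sW cov); lia.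
move=> w c; rewrite inE => /predU1P[->|//] Cc wc.
by exfalso; apply: (gap c) => //; lia.
Qed.

Lemma extend_down1 (C : set int) W a b : arbitrarily_long_gaps C ->
  covers C W a b -> exists W', extension C W a b W' (a - 1) b.
Proof.
move=> gapC cov.
have [/= ca|nca] := pselect (sumset [set` W] C (a - 1)).
  exists W; split=> //; first lia.
  move=> z zab; have [->//|za] := eqVneq z (a - 1); apply: cov; lia.
(* Now [p] is sent to [a - 1] and [q] beyond [b]. *)
have [p [q [Cp Cq pq gap]]] := gapC (b - a + 1).
have sW : {subset W <= a - 1 - p :: W} by move=> w wW; rewrite inE wW orbT.
exists (a - 1 - p :: W); split=> //; first lia.
  move=> z zab; have [->|za] := eqVneq z (a - 1).
    by apply/sumsetP; exists (a - 1 - p); [exact: mem_head|rewrite subKr].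
  apply: (covers_subset sW cov); lia.
move=> w c; rewrite inE => /predU1P[->|//] Cc wc.
by exfalso; apply: (gap c) => //; lia.
Qed.

Lemma extend_up (C : set int) W a b (n : nat) : arbitrarily_long_gaps C ->
  covers C W a b -> exists W', extension C W a b W' a (b + n%:Z).
Proof.
move=> gapC cov; elim: n => [|n [W1 ext1]].
  by exists W; rewrite addr0; apply: extension_refl.
have [_ _ _ cov1 _] := ext1.
have [W2 ext2] := extend_up1 gapC cov1; exists W2.
have -> : b + n.+1%:Z = b + n%:Z + 1 by lia.
exact: extension_trans ext1 ext2.
Qed.

Lemma exists_uncovered_above (C : set int) (W : seq int) (N : int) :
  (forall c, C c -> 0 <= c) -> arbitrarily_long_gaps C ->
  exists2 x, N < x & ~ sumset [set` W] C x.
Proof.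
move=> C0 gapC.
have [m m0 Wm] : exists2 m : int, 0 <= m & forall w, w \in W -> - m <= w <= m.
  elim: W => [|v W [m m0 Wm]]; first by exists 0.
  exists (m + `|v|); first lia.
  by move=> w; rewrite inE => /predU1P[->|/Wm]; lia.
have [p [q [Cp Cq pq gap]]] := gapC (m + m + 1 + `|N|).
have := C0 p Cp => p0.
(* For [w] in [[-m, m]] the difference [q - 1 - m - w] lies in [[q - 1 - 2m, q - 1]], inside the
   gap. *)
exists (q - 1 - m); first lia.
by move=> /sumsetP[w /= /Wm wm]; apply: gap; lia.
Qed.

Lemma exists_first_uncovered (C : set int) (W : seq int) (b : int) :
  (forall c, C c -> 0 <= c) -> arbitrarily_long_gaps C ->
  exists x, [/\ b < x, ~ sumset [set` W] C x & covers C W (b + 1) (x - 1)].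
Proof.
move=> C0 gapC; have [y yb ny] := @exists_uncovered_above C W b C0 gapC.
have ex : exists n : nat, `[< ~ sumset [set` W] C (b + 1 + n%:Z) >].
  exists `|(y - (b + 1))%R|%N; apply/asboolP.
  by have -> : b + 1 + `|(y - (b + 1))%R|%N%:Z = y by lia.
case: (ex_minnP ex) => n /asboolP nn nmin; exists (b + 1 + n%:Z); split=> //; first lia.
move=> z zb; apply: contrapT => nz.
have /nmin : `[< ~ sumset [set` W] C (b + 1 + `|(z - (b + 1))%R|%N%:Z) >].
  by apply/asboolP; have -> : b + 1 + `|(z - (b + 1))%R|%N%:Z = z by lia.
lia.
Qed.

(** This passes to subsets of [W], so it survives the later shrinking of [W]. *)
Definition unique_summand (C W : set int) (c x : int) : Prop :=
  forall w c', W w -> C c' -> w + c' = x -> c' = c.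

Lemma extend_with_unique_summand (C : set int) W a b c :
  (forall c, C c -> 0 <= c) -> arbitrarily_long_gaps C -> C c ->
  a <= b + 1 -> covers C W a b ->
  exists W' a' b' x, [/\ extension C W a b W' a' b', a' < a, b < b',
    a' <= x <= b' & unique_summand C [set` W'] c x].
Proof.
move=> C0 gapC Cc ab cov; have c0 := C0 c Cc.
have [W1 ext1] := @extend_up C W a b `|c|%N gapC cov.
have [sW1 _ _ cov1 old1] := ext1.
have [x [xb nx covx]] := @exists_first_uncovered C W1 (b + `|c|%N%:Z) C0 gapC.
have sW2 : {subset W1 <= x - c :: W1} by move=> w wW; rewrite inE wW orbT.
have cov2 : covers C (x - c :: W1) a x.
  move=> z zax; have [->|zx] := eqVneq z x.
    by apply/sumsetP; exists (x - c); [exact: mem_head|rewrite subKr].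
  have [zb|bz] := lerP z (b + `|c|%N%:Z).
    by apply: (covers_subset sW2 cov1); lia.
  by apply: (covers_subset sW2 covx); lia.
have ext2 : extension C W a b (x - c :: W1) a x.
  split=> //; first by move=> w /sW1/sW2.
    lia.
  move=> w c'; rewrite inE => /predU1P[->|wW1 Cc'] ; last exact: old1.
  by move=> /C0; lia.
(* The move to the left makes both ends advance; its translate avoids [[a, x]] and so adds no
   representation of [x]. *)
have [W3 ext3] := extend_down1 gapC cov2.
have [_ _ _ _ old3] := ext3.
exists W3, (a - 1), x, x; split; [exact: extension_trans ext2 ext3|lia|lia|lia|].
move=> w c' /= wW3 Cc' wc'.
have := old3 w c' wW3 Cc'; rewrite inE wc' => /(_ _)/predU1P[|wx|wW1].
- lia.
- lia.
- by case: nx; exists w => //; exists c'.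
Qed.

(** * The complement as a union of finite stages *)

Lemma exists_locally_finite_complement (C : set int) (c : nat -> int) :
  (forall x, C x -> 0 <= x) -> arbitrarily_long_gaps C -> range c = C ->
  exists W, [/\ sumset W C = setT,
    forall z, finite_set [set w | W w /\ C (z - w)] &
    forall y, C y -> exists x, unique_summand C W y x].
Proof.
move=> C0 gapC cC.
pose state : Type := (seq int * int * int)%type.
(* The slack [+ 1] admits the empty interval [[1, 0]] of the initial stage. *)
pose ok (s : state) := s.1.2 <= s.2 + 1 /\ covers C s.1.1 s.1.2 s.2.
pose ext (s s' : state) := extension C s.1.1 s.1.2 s.2 s'.1.1 s'.1.2 s'.2.
(* The guard [ok] makes the relation total, as [choice] requires; step [k] treats the element
   [c k]. *)
pose next (ks : nat * state) (s' : state) := ok ks.2 ->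
  [/\ ok s', ext ks.2 s', s'.1.2 < ks.2.1.2, ks.2.2 < s'.2 &
    exists2 x, s'.1.2 <= x <= s'.2 & unique_summand C [set` s'.1.1] (c ks.1) x].
have [f fP] : {f & forall ks, next ks (f ks)}.
  apply: choice => -[k [[W a] b]].
  have [[/= ab cov]|nok] := pselect (ok (W, a, b)); last by exists (W, a, b).
  have Cck : C (c k) by rewrite -cC; exists k.
  have [W' [a' [b' [x [e aa bb xab xu]]]]] :=
    extend_with_unique_summand C0 gapC Cck ab cov.
  exists (W', a', b') => _; split=> //; last by exists x.
  by case: e => _ _ _ cov' _; split=> //=; lia.
pose S := fix S n : state := if n is k.+1 then f (k, S k) else ([::], 1, 0).
have okS n : ok (S n).
  elim: n => [|n IHn]; first by split=> // z; rewrite /=; lia.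
  by have [] := fP (n, S n) IHn.
have nextS n := fP (n, S n) (okS n).
have extS m n : (m <= n)%N -> ext (S m) (S n).
  move=> /subnK <-; elim: (n - m)%N => [|k IHk].
    by apply: extension_refl; have [] := okS m.
  rewrite addSn; apply: extension_trans IHk _.
  by have [] := nextS (k + m)%N.
have a_small n : (S n).1.2 <= 1 - n%:Z.
  by elim: n => [//|n IHn]; have [_ _ + _ _] := nextS n; rewrite /=; lia.
have b_large n : n%:Z <= (S n).2.
  by elim: n => [//|n IHn]; have [_ _ _ + _] := nextS n; rewrite /=; lia.
pose W : set int := \bigcup_n [set` (S n).1.1].
(* Representations of points of the [n]-th interval are settled at stage [n]; this yields both local
   finiteness and uniqueness of summands in the limit. *)
have old n w y : W w -> C y -> (S n).1.2 <= w + y <= (S n).2 -> w \in (S n).1.1.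
  move=> [m _ /= wm] Cy wy; have [mn|/ltnW nm] := leqP m n.
    by have [/(_ _ wm)] := extS _ _ mn.
  by have [_ _ _ _ /(_ _ _ wm Cy wy)] := extS _ _ nm.
(* The left end is only known to be at most [1 - n], hence stage [|z| + 1]. *)
have inS (z : int) : (S `|z|.+1%N).1.2 <= z <= (S `|z|.+1%N).2.
  by have := a_small `|z|.+1%N; have := b_large `|z|.+1%N; lia.
exists W; split.
- apply/seteqP; split=> // z _; have [_ cov] := okS `|z|.+1%N.
  have := cov z (inS z); apply: sumsetSl => w wS.
  by exists `|z|.+1%N.
- move=> z; apply: (@sub_finite_set _ _ [set` (S `|z|.+1%N).1.1]); last first.
    exact: finite_seq.
  by move=> w [Ww Czw]; apply: (old _ _ _ Ww Czw); rewrite subrKC; exact: inS.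
- move=> y; rewrite -{1}cC => -[k _ <-].
  have [_ _ _ _ [x xS xu]] := nextS k.
  exists x => w c' Ww Cc' wc'; apply: (xu w c') => //.
  by apply: (old k.+1 w c') => //; rewrite wc'.
Qed.

Lemma co_minimal_pair_of_long_gaps (C : set int) (c : nat -> int) :
  (forall x, C x -> 0 <= x) -> arbitrarily_long_gaps C -> range c = C ->
  exists W, co_minimal_pair C W.
Proof.
move=> C0 gapC cC.
have [W [WC Wfin Wu]] := exists_locally_finite_complement C0 gapC cC.
have [V VW Vmin] := locally_finite_minimal_complement WC Wfin.
have [VC _] := Vmin.
exists V; split=> //; split; first by rewrite sumsetC.
move=> C' [C'C CC'] C'V; apply: CC' => y Cy.
have [x xu] := Wu y Cy.
have : sumset C' V x by rewrite C'V.
move=> [c' C'c' [v Vv xE]].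
by rewrite -(xu v c' (VW _ Vv) (C'C _ C'c')) // addrC.
Qed.

(** * From the limit superior to long gaps *)

Lemma unbounded_of_limn_esup (R : realType) (u : nat -> R) (L : R) :
  limn_esup (fun i => (u i)%:E) = +oo%E -> exists i, L < u i.
Proof.
move=> uoo; apply: contrapT => nL.
have uL i : u i <= L by rewrite leNgt; apply/negP => Lu; apply: nL; exists i.
suff : (limn_esup (fun i => (u i)%:E) <= L%:E)%E by rewrite uoo.
rewrite /limn_esup /limf_esup.
(* The limit superior is an infimum of suprema, one of which runs over all indices. *)
apply: (@le_trans _ _ (ereal_sup ((fun i => (u i)%:E) @` setT))).
  by apply: ereal_inf_lbound; exists setT => //; exact: filterT.
by apply: ge_ereal_sup => _ [i _ <-]; rewrite lee_fin.
Qed.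

Theorem theorem2 (R : realType) (C : set nat) (c : nat -> nat)
    (C_infinite : infinite_set C)
    (C_enum : increasing_enumeration C c)
    (limsup_gaps :
      limn_esup (fun i : nat => ((c i.+1)%:R - (c i)%:R : R)%:E) = +oo%E) :
  exists W : set int, co_minimal_pair (int_of_nat_set C) W.
Proof.
have [cmono cC] := C_enum.
apply: (@co_minimal_pair_of_long_gaps _ (fun i => (c i)%:Z)).
- by move=> _ [n _ <-].
- move=> L; have [i Li] := unbounded_of_limn_esup (`|L|%N%:R) limsup_gaps.
  have Cc j : int_of_nat_set C (c j)%:Z by exists (c j) => //; rewrite -cC; exists j.
  exists (c i)%:Z, (c i.+1)%:Z; split=> //.
    move: Li; rewrite ltrBrDr -natrD ltr_nat; lia.
  (* Monotonicity of [c] leaves no value strictly between [c i] and [c i.+1]. *)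
  move=> y cy [n + nE]; rewrite -cC => -[j _ jn].
  have [ji|ij] := leqP j i.
    have : (c j <= c i)%N.
      by move: ji; rewrite leq_eqVlt => /predU1P[->//|/cmono/ltnW].
    lia.
  have : (c i.+1 <= c j)%N.
    by move: ij; rewrite leq_eqVlt => /predU1P[->//|/cmono/ltnW].
  lia.
- by rewrite /int_of_nat_set -cC image_comp.
Qed.
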